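(* Let $L=p_1^{\alpha_1}p_2^{\alpha_2}\cdots p_{r-1}^{\alpha_{r-1}}p_r^{\alpha_r}\in\mathcal{L}$, where $r>1$, $2=p_1<p_2<\cdots<p_r$ are the primes and $\alpha_1,\dots,\alpha_r$ the exponents occurring in the definition of $\mathcal{L}$ (so that $\alpha_r=1$). Let $M$ be a minimal set of moduli with $\operatorname{lcm}(M)=L$. Let $\Gamma_M$ be the set of all coverings having $M$ as set of moduli, and let $C\in\Gamma_M$. Put $$C_{p_r}=\{(x,m)\in C: p_r\,\|\,m\},\qquad C_{p_{r-1}^{\alpha_{r-1}}}=\{(x,m)\in C: p_{r-1}^{\alpha_{r-1}}\,\|\,m \text{ and } p_r\nmid m\},$$ $$Q=\{(x,m)\in C_{p_r}: p_{r-1}^{\alpha_{r-1}}\nmid m\}.$$ Then $$|\Gamma_M|=\frac{\left(|C_{p_r}|-|Q|\right)!}{\left(p_{r-1}-\left|C_{p_{r-1}^{\alpha_{r-1}}}\right|\right)!\,\left(p_r-|Q|\right)!}\prod_{i=1}^{r}(p_i!)^{\alpha_i}.$$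
   Context: A covering is a finite collection $C=\{(x_i,m_i)\}_{i\in I}$ of congruences $z\equiv x_i\pmod{m_i}$, with integers $x_i\ge 0$, $m_i\ge 2$ and with pairwise distinct moduli $m_i$, such that every integer satisfies at least one of the congruences. The set of moduli of $C$ is $M=\{m_i: i\in I\}$, and $\operatorname{lcm}(M)$ is the least common multiple of its elements. Residues are taken modulo the corresponding modulus (i.e. $0\le x_i<m_i$), so two coverings with the same moduli are equal iff the residue class attached to each modulus is the same. For a finite set $M$ of integers $\ge 2$, $\Gamma_M$ is the set of all coverings whose set of moduli is exactly $M$. A covering is minimal if no proper subset of it is a covering. A set $M$ with $\Gamma_M\neq\emptyset$ is minimal if every $C\in\Gamma_M$ is minimal. The notation $p^t\,\|\,m$ means $p^t\mid m$ and $p^{t+1}\nmid m$. The cardinalities $|C_{p_r}|$, $|C_{p_{r-1}^{\alpha_{r-1}}}|$ and $|Q|$ depend only on $M$, not on the choice of $C\in\Gamma_M$. A positive integer $N$ is a covering number if there is a covering with distinct moduli all of which are divisors of $N$ greater than $1$; it is a primitive covering number if in addition no proper divisor of $N$ is a covering number. The set $\mathcal{L}$ consists of all integers of the form $p_1^{\alpha_1}\cdots p_r^{\alpha_r}$ where $r>1$, $2=p_1<p_2<\cdots<p_r$ are primes with $p_{t+1}\equiv 1\pmod{p_t-1}$ for all $0<t<r-1$ and $p_r\ge (p_{r-1}-2)(p_{r-1}-3)$, and $$\alpha_t=\frac{p_{t+1}-1}{p_t-1}-1\ \ (1\le t\le r-2),\qquad \alpha_{r-1}=\left\lfloor\frac{p_r-1}{p_{r-1}-1}\right\rfloor,\qquad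 \alpha_r=1.$$ (By a theorem of Z.-W. Sun, all elements of $\mathcal{L}$ are primitive covering numbers.) *)

(* Defs.v *)
From mathcomp Require Import all_boot all_order all_algebra.
From mathcomp Require Import finmap.
From mathcomp Require Import all_classical.

Set Implicit Arguments.
Unset Strict Implicit.
Unset Printing Implicit Defensive.

Import Order.TTheory GRing.Theory Num.Theory.

Local Open Scope nat_scope.
Local Open Scope fset_scope.

(* A pair (x, m) stands for the residue class of x modulo m.  Residues are
   reduced (x < m), so that two collections describe the same residue classes
   exactly when they are equal. *)
Definition is_covering (C : {fset nat * nat}) : Prop :=
  [/\ forall c, c \in C -> 2 <= c.2 /\ c.1 < c.2,
      {in C &, injective snd}
    & forall z : int, exists2 c, c \in C & (z = c.1 %[mod c.2])%Z].

Definition minimal_covering (C : {fset nat * nat}) : Prop :=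
  is_covering C /\ forall D : {fset nat * nat}, D `<` C -> ~ is_covering D.

Definition moduli (C : {fset nat * nat}) : {fset nat} := [fset c.2 | c in C].

Definition Gamma (M : {fset nat}) : set {fset nat * nat} :=
  [set C | is_covering C /\ moduli C = M]%classic.

Definition minimal_moduli (M : {fset nat}) : Prop :=
  (Gamma M !=set0)%classic /\ forall C, Gamma M C -> minimal_covering C.

Definition lcm_of (M : {fset nat}) : nat := \big[lcmn/1]_(m <- M) m.

(* p ^ t || m; the prime p is raised to the exact power t in m. *)
Definition exact_dvd (p t m : nat) : bool :=
  (p ^ t %| m) && ~~ (p ^ t.+1 %| m).

(* L belongs to the family \mathcal{L} of primitive covering numbers found by
   Z.-W. Sun, with primes p 1 < ... < p r and exponents
   alpha 1, ..., alpha r; the values of p and alpha outside 1, ..., r play no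
   role.  All truncated operations agree with the usual ones here: p t >= 2,
   the division defining alpha t for t <= r - 2 is exact with quotient at
   least 2, and for p r.-1 = 2 the product (2 - 2) * (2 - 3) is 0. *)
Definition in_calL (r : nat) (p alpha : nat -> nat) (L : nat) : Prop :=
  [/\ 1 < r,
      [/\ forall t, 1 <= t <= r -> prime (p t),
          p 1 = 2
        & forall t, 1 <= t < r -> p t < p t.+1],
      (forall t, 0 < t < r.-1 -> p t.+1 = 1 %[mod p t - 1]) /\
      (p r.-1 - 2) * (p r.-1 - 3) <= p r,
      [/\ forall t, 1 <= t <= r - 2 ->
            alpha t = (p t.+1 - 1) %/ (p t - 1) - 1,
          alpha r.-1 = (p r - 1) %/ (p r.-1 - 1)
        & alpha r = 1]
    & L = \prod_(1 <= t < r.+1) p t ^ alpha t].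

Section Parts.
Variables (r : nat) (p alpha : nat -> nat) (C : {fset nat * nat}).

Definition C_last : {fset nat * nat} :=
  [fset c in C | exact_dvd (p r) 1 c.2].

Definition C_penult : {fset nat * nat} :=
  [fset c in C | exact_dvd (p r.-1) (alpha r.-1) c.2 && ~~ (p r %| c.2)].

Definition Q_part : {fset nat * nat} :=
  [fset c in C_last | ~~ (p r.-1 ^ alpha r.-1 %| c.2)].

End Parts.

(* Main.v *)
(* Put q = p_(r-1), P = p_r and A = L / (q P), and list the prime factors of L
   in increasing order.  Along the partial products of this list the number of
   divisors grows at each step, except at P, by exactly the new prime minus
   one; so a class left uncovered by the moduli dividing one partial product
   has an uncovered lift to the next.  If M missed a divisor d > 1 of A, two
   integers y1, y2 uncovered by all moduli prime to P would already differ
   modulo a low power of q times the preceding part of L.  For each b modulo P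
   the two classes (y_i mod q A, b mod P) must be hit by moduli divisible by P,
   and one modulus can serve both only if its part prime to P divides y1 - y2;
   there are too few divisors of L for that.  So M contains all divisors of A
   greater than 1, and these leave exactly one class modulo A uncovered.

   By minimality, if the congruences of a covering are added one at a time in
   the order of the partial products, each of them meets the set still
   uncovered.  Conversely this set always consists of n classes that are
   pairwise distinct modulo the next modulus, where n does not depend on the
   earlier residues, so that residue can be chosen in n ways.  Multiplying the
   n gives the formula. *)

Require Import Defs.
From mathcomp Require Import all_boot all_order all_algebra.
From mathcomp Require Import finmap.
From mathcomp Require Import all_classical.
From mathcomp Require Import zify ring.

Set Implicit Arguments.
Unset Strict Implicit.
Unset Printing Implicit Defensive.

Import Order.TTheory GRing.Theory Num.Theory.

Local Open Scope nat_scope.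

(** * Enumeration of irredundant coverings along a fixed order of the moduli *)

(* The lists of pairs (residue, modulus), with moduli ms in this order, that
   cover all z < L with W z and in which every class meets the part of W that
   the preceding classes leave uncovered. *)
Fixpoint irr_covers (L : nat) (ms : seq nat) (W : pred nat)
    : seq (seq (nat * nat)) :=
  if ms is m :: ms' then
    flatten [seq [seq (x, m) :: s |
                    s <- irr_covers L ms' [pred z | W z && (z %% m != x)]] |
             x <- [seq x <- iota 0 m |
                     has (fun z => W z && (z %% m == x)) (iota 0 L)]]
  else if has W (iota 0 L) then [::] else [:: [::]].

Lemma eq_irr_covers L ms (W W' : pred nat) :
  W =1 W' -> irr_covers L ms W = irr_covers L ms W'.
Proof.
elim: ms W W' => [|m ms IHms] W W' eqW /=; first by rewrite (eq_has eqW).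
congr flatten; rewrite (@eq_filter _ _ (fun x => has
    (fun z => W' z && (z %% m == x)) (iota 0 L))); last first.
  by move=> x; apply: eq_has => z; rewrite eqW.
apply: eq_map => x; congr map; apply: IHms => z /=; by rewrite eqW.
Qed.

Lemma irr_covers_consP L m ms W s :
  reflect (exists x s', [/\ s = (x, m) :: s', x < m,
             (exists2 z, z < L & W z && (z %% m == x))
           & s' \in irr_covers L ms [pred z | W z && (z %% m != x)]])
          (s \in irr_covers L (m :: ms) W).
Proof.
apply: (iffP flattenP) => [[l /mapP[x]]|[x [s' [-> xm [z zL Wz] s'in]]]].
  rewrite mem_filter mem_iota => /andP[/hasP[z]].
  rewrite mem_iota => zL Wz xm -> /mapP[s' s'in ->].
  by exists x, s'; split=> //; exists z.
exists [seq (x, m) :: s | s <- irr_covers L ms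
                                 [pred z | W z && (z %% m != x)]].
  apply/mapP; exists x => //; rewrite mem_filter mem_iota /= add0n xm andbT.
  by apply/hasP; exists z; rewrite ?mem_iota.
by apply/mapP; exists s'.
Qed.

Lemma irr_covers_uniq L ms W : uniq (irr_covers L ms W).
Proof.
elim: ms W => [|m ms IHms] W /=; first by case: ifP.
apply: (@allpairs_uniq_dep _ (fun=> seq (nat * nat)) _
         (fun x s => (x, m) :: s)).
- by rewrite filter_uniq // iota_uniq.
- by move=> x _; apply: IHms.
- by move=> [x s] [y t] _ _ /= [-> ->].
Qed.

Lemma irr_covers_sound L ms W s : s \in irr_covers L ms W ->
  [/\ map snd s = ms, forall c, c \in s -> c.1 < c.2
    & forall z, z < L -> W z -> exists2 c, c \in s & z %% c.2 == c.1].
Proof.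
elim: ms W s => [|m ms IHms] W s.
  rewrite /=; case: ifP => // /negbT/hasPn noW; rewrite inE => /eqP->.
  by split=> // z zL Wz; have := noW z; rewrite mem_iota Wz => /(_ zL).
case/irr_covers_consP=> x [s' [-> xm _ /IHms[<- s'lt s'cov]]].
split=> // [c|z zL Wz]; first by rewrite inE => /predU1P[->//|/s'lt].
case zx: (z %% m == x); first by exists (x, m); rewrite ?mem_head.
have [c cs' zc] := s'cov z zL (introT andP (conj Wz (negbT zx))).
by exists c; rewrite ?inE ?cs' ?orbT.
Qed.

(** A point covered by [c] alone is still uncovered when [c] is reached, whichever classes come
    first; so this symmetric irredundancy implies the one built into [irr_covers]. *)
Lemma irr_covers_complete L (s : seq (nat * nat)) (W : pred nat) :
    uniq (map snd s) -> (forall c, c \in s -> c.1 < c.2) ->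
    (forall z, z < L -> W z -> exists2 c, c \in s & z %% c.2 == c.1) ->
    (forall c, c \in s -> exists z, [/\ z < L, W z, z %% c.2 == c.1
       & forall c', c' \in s -> c' != c -> z %% c'.2 != c'.1]) ->
  s \in irr_covers L (map snd s) W.
Proof.
elim: s W => [|[x m] s IHs] W.
  move=> _ _ cov _ /=; case: ifP => // /hasP[z]; rewrite mem_iota => zL Wz.
  by have [] := cov z zL Wz.
rewrite map_cons [snd _]/= => /andP[ms us] slt cov irr.
apply/irr_covers_consP; exists x, s; split=> //.
- exact: (slt (x, m) (mem_head _ _)).
- have [z [zL Wz zx _]] := irr _ (mem_head _ _).
  by exists z => //; rewrite Wz.
apply: IHs => // [c cs|z zL|c cs].
- by apply: slt; rewrite inE cs orbT.
- case/andP=> Wz zx; have [c] := cov z zL Wz.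
  rewrite inE => /predU1P[->/=|cs zc]; first by rewrite (negPf zx).
  by exists c.
have [|z [zL Wz zc zother]] := irr c; first by rewrite inE cs orbT.
exists z; split=> //=; last by move=> c' c's; apply: zother; rewrite inE c's orbT.
rewrite Wz; apply: (zother (x, m)); rewrite ?mem_head //.
by apply: contraNneq ms => e; apply/mapP; exists c; rewrite // -e.
Qed.

Lemma size_irr_covers_cons L m ms W c :
    (forall x, has (fun z => W z && (z %% m == x)) (iota 0 L) ->
       size (irr_covers L ms [pred z | W z && (z %% m != x)]) = c) ->
  size (irr_covers L (m :: ms) W) =
    count (fun x => has (fun z => W z && (z %% m == x)) (iota 0 L))
          (iota 0 m) * c.
Proof.
move=> cE /=; rewrite size_flatten /shape -map_comp -size_filter.
elim: (iota 0 m) => //= x s IHs; case: ifP => //= Hx.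
by rewrite size_map cE // IHs mulSn.
Qed.

(** * Choices of residues when the moduli separate the uncovered classes *)

Definition in_classes (N : nat) (Z : seq nat) : pred nat :=
  [pred z | has (fun y => z == y %[mod N]) Z].

(* The extra predicate V is needed for the moduli p_r d with p_(r-1)^alpha not
   dividing p_r d: they separate classes modulo p_r A, but the uncovered set is
   only a union of classes modulo p_r p_(r-1) A. *)
Lemma size_irr_covers_separated L N (V W : pred nat) Z ms1 ms2 c :
    W =1 [pred z | V z && in_classes N Z z] -> uniq Z ->
    (forall y, y \in Z -> exists2 z, z < L & V z && (z == y %[mod N])) ->
    (forall m, m \in ms1 -> [/\ 0 < m, m %| N
       & {in Z &, forall y y', y = y' %[mod m] -> y = y'}]) ->
    (forall Z' : seq nat, {subset Z' <= Z} -> uniq Z' -> size Z' = size Z - size ms1 ->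
       size (irr_covers L ms2 [pred z | V z && in_classes N Z' z]) = c) ->
  size (irr_covers L (ms1 ++ ms2) W) = size Z ^_ size ms1 * c.
Proof.
elim: ms1 W Z => [|m ms1 IHms] W Z WE uZ meetV sep cE.
  by rewrite ffactn0 mul1n (eq_irr_covers _ _ WE) cE // subn0.
have [m0 mN msep] := sep m (mem_head _ _).
have modm z y : z == y %[mod N] -> z %% m = y %% m.
  by move/eqP/(congr1 (modn^~ m)); rewrite !modn_dvdm.
have hitE x : has (fun z => W z && (z %% m == x)) (iota 0 L) =
              (x \in [seq y %% m | y <- Z]).
  apply/hasP/mapP=> [[z _ /andP[]]|[y yZ ->]].
    rewrite WE => /andP[_ /hasP[y yZ /modm zy]] /eqP <-.
    by exists y.
  have [z zL /andP[Vz zy]] := meetV y yZ.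
  exists z; rewrite ?mem_iota // WE /= Vz /= (modm _ _ zy) eqxx andbT.
  by apply/hasP; exists y.
(* Since [m] separates [Z], there are [size Z] admissible residues and each removes one class: the
   recursion of the falling factorial. *)
rewrite cat_cons (@size_irr_covers_cons L m _ W ((size Z).-1 ^_ size ms1 * c)).
  rewrite [size (_ :: _)]/= ffactnS mulnA; congr (_ * _ * _).
  rewrite (eq_count hitE) -size_filter -(size_map (modn^~ m) Z).
  apply: perm_size; apply: uniq_perm.
  - by rewrite filter_uniq ?iota_uniq.
  - rewrite map_inj_in_uniq // => y y' yZ y'Z; exact: msep.
  - move=> x; rewrite mem_filter mem_iota /= add0n andbC.
    by case xZ: (x \in _) => //; rewrite ?andbF //; move/mapP: xZ => [y _ ->];
      rewrite ltn_pmod.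
move=> x; rewrite hitE => /mapP[y0 y0Z ->].
have sZ : size (rem y0 Z) = (size Z).-1 by rewrite size_rem.
have subZ : {subset rem y0 Z <= Z} by move=> y /mem_rem.
rewrite -sZ; apply: IHms => [z /=||y yZ|m' m'ms|Z' subZ' uZ' sZ'].
- rewrite WE /= -andbA; congr andb; apply/andP/hasP.
    case=> /hasP[y yZ zy] zy0; exists y => //.
    rewrite mem_rem_uniq // inE yZ andbT.
    by apply: contraNneq zy0 => <-; rewrite (modm _ _ zy).
  case=> y; rewrite mem_rem_uniq // inE => /andP[yy0 yZ] zy.
  split; first by apply/hasP; exists y.
  by rewrite (modm _ _ zy); apply: contraNneq yy0 => /msep ->.
- exact: rem_uniq.
- by apply: meetV; apply: subZ.
- have [|? ? msep'] := sep m'; first by rewrite inE m'ms orbT.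
  by split=> // y y' /subZ yZ /subZ y'Z; apply: msep'.
- apply: cE => //; first by move=> y /subZ'/subZ.
  by rewrite sZ' sZ /= -subn1 -subnDA add1n.
Qed.

(** * Lifting a residue class by a prime factor *)

(** As [k] is coprime to [p], the gcd of [p * A] and [k * A] is [A]. *)
Lemma dvdn_cancel_prime p m A k :
  prime p -> m %| p * A -> m %| k * A -> ~~ (p %| k) -> m %| A.
Proof.
move=> pp mp mk; rewrite -prime_coprime // => /eqP cpk.
by rewrite -[A]mul1n -cpk muln_gcdl dvdn_gcd mp.
Qed.

(** The lifts differ by [(j - i) * A] with [j - i < p]; if this were nonzero, cancelling [p] would
    give [m %| A]. So one new modulus hits at most one lift of a class. *)
Lemma lifts_separated p A m x i j : prime p -> m %| p * A -> ~~ (m %| A) ->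
  i < p -> j < p -> x + i * A = x + j * A %[mod m] -> i = j.
Proof.
move=> pp mpA mA; wlog ij : i j / i <= j => [hw ip jp e|ip jp /esym/eqP].
  by case: (leqP i j) => [/hw->//|/ltnW/hw->].
rewrite eqn_mod_dvd ?leq_add2l ?leq_mul // subnDl -mulnBl => mij.
apply/eqP; rewrite eqn_leq ij leqNgt; apply: contraNN mA => lt_ij.
apply: (dvdn_cancel_prime pp mpA mij); rewrite gtnNdvd ?subn_gt0 //.
exact: leq_ltn_trans (leq_subr _ _) jp.
Qed.

Lemma lift_of_class p A x z : 0 < p -> z = x %[mod A] ->
  exists2 i, i < p & z = x + i * A %[mod p * A].
Proof.
move=> p0 zx; case: (posnP A) zx => [->|A0 zx].
  by rewrite !modn0 => ->; exists 0; rewrite ?muln0 ?modn0 ?addn0.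
(* Adding [x * (p * A)] keeps the class of [z] and makes the subtraction of [x] exact. *)
have le_x : x <= z + x * (p * A).
  apply: leq_trans (leq_addl _ _); rewrite leq_pmulr // muln_gt0 p0 //.
have : A %| z + x * (p * A) - x.
  rewrite -eqn_mod_dvd // -modnDmr mulnA modnMl addn0; exact/eqP.
case/dvdnP=> k ek; exists (k %% p); first by rewrite ltn_pmod.
rewrite muln_modl modnDmr -ek subnKC //.
by rewrite -[in RHS]modnDmr modnMl addn0.
Qed.

Definition lifts (x A p : nat) : seq nat := [seq x + i * A | i <- iota 0 p].

Lemma mem_lifts x A p y :
  reflect (exists2 i, i < p & y = x + i * A) (y \in lifts x A p).
Proof.
apply: (iffP mapP) => [[i]|[i ip ->]]; last by exists i; rewrite ?mem_iota.
by rewrite mem_iota => ip ->; exists i.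
Qed.

Lemma lifts_uniq x A p : 0 < A -> uniq (lifts x A p).
Proof.
move=> A0; rewrite map_inj_uniq ?iota_uniq // => i j /addnI/eqP.
by rewrite eqn_pmul2r // => /eqP.
Qed.

Lemma size_lifts x A p : size (lifts x A p) = p.
Proof. by rewrite size_map size_iota. Qed.

Lemma in_classes_lifts x A p z : 0 < p ->
  in_classes (p * A) (lifts x A p) z = (z == x %[mod A]).
Proof.
move=> p0; apply/hasP/idP => [[y /mem_lifts[i _ ->] /eqP]|/eqP].
  move/(congr1 (modn^~ A)); rewrite !modn_dvdm ?dvdn_mull // => ->.
  by rewrite -modnDmr modnMl addn0.
case/(lift_of_class p0) => i ip /eqP zi.
by exists (x + i * A) => //; apply/mem_lifts; exists i.
Qed.

(** * Full blocks of moduli along a chain of primes *)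

Definition block (M : seq nat) (A B : nat) : seq nat :=
  [seq m <- M | (m %| B) && ~~ (m %| A)].

Lemma mem_block M A B m :
  (m \in block M A B) = [&& m \in M, m %| B & ~~ (m %| A)].
Proof. by rewrite mem_filter andbC. Qed.

Fixpoint chain_blocks (M : seq nat) (A : nat) (cs : seq nat) : seq nat :=
  if cs is p :: cs' then block M A (p * A) ++ chain_blocks M (p * A) cs'
  else [::].

(** When [p] raises the number of divisors by [p.-1], a block has this size exactly if every divisor
    new at that step is a modulus. *)
Fixpoint chain_full (M : seq nat) (A : nat) (cs : seq nat) : bool :=
  if cs is p :: cs' then
    (size (block M A (p * A)) == p.-1) && chain_full M (p * A) cs'
  else true.

Lemma mem_chain_blocks M A cs m : (m \in chain_blocks M A cs) =
  [&& m \in M, m %| A * \prod_(p <- cs) p & ~~ (m %| A)].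
Proof.
elim: cs A => [|p cs IHcs] A /=; first by rewrite big_nil muln1 andbN andbF.
rewrite mem_cat mem_block IHcs big_cons (mulnC p A) -mulnA.
case: (m \in M) => //=; case mA: (m %| A).
  by rewrite (dvdn_mulr _ mA) !andbF.
rewrite !andbT; case mpA: (m %| A * p) => //=; last by rewrite andbT.
by rewrite mulnA (dvdn_mulr _ mpA).
Qed.

Lemma chain_blocks_uniq M A cs : uniq M -> uniq (chain_blocks M A cs).
Proof.
move=> uM; elim: cs A => [//|p cs IHcs] A /=.
rewrite cat_uniq IHcs filter_uniq //= andbT; apply/hasPn=> m.
by rewrite mem_chain_blocks mem_block => /and3P[_ _ /negPf->]; rewrite andbF.
Qed.

(** A full block has [p.-1] moduli separating the [p] lifts of the current class: it admits
    [p ^_ p.-1] = [p]! choices and leaves one class modulo [p * A], from which the argument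
    repeats. *)
Lemma size_irr_covers_chain L M cs A x rest c :
    0 < A -> 0 < L -> A * \prod_(p <- cs) p %| L -> all prime cs ->
    chain_full M A cs ->
    (forall x', size (irr_covers L rest
       [pred z | z == x' %[mod A * \prod_(p <- cs) p]]) = c) ->
  size (irr_covers L (chain_blocks M A cs ++ rest)
          [pred z | z == x %[mod A]]) = \prod_(p <- cs) p`! * c.
Proof.
move=> A0 L0; elim: cs A A0 x => [|p cs IHcs] A A0 x /=.
  by rewrite !big_nil muln1 mul1n => _ _ _ ->.
rewrite !big_cons => AL /andP[pp pcs] /andP[/eqP sizeb fullcs] cE.
have p0 := prime_gt0 pp; have pA0 : 0 < p * A by rewrite muln_gt0 p0.
have p1 : p - p.-1 = 1 by case: p p0 {pp AL cE pA0 sizeb fullcs} => // p _; rewrite subSnn.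
have pAcs : A * (p * \prod_(p <- cs) p) = p * A * \prod_(p <- cs) p.
  by rewrite mulnA (mulnC A).
rewrite pAcs in AL cE.
have pAL : p * A %| L by apply: dvdn_trans AL; apply: dvdn_mulr.
rewrite -catA (@size_irr_covers_separated L (p * A) predT _ (lifts x A p)
  _ _ (\prod_(p <- cs) p`! * c)).
- rewrite size_lifts sizeb mulnA; congr (_ * _).
  by rewrite ffact_factd ?leq_pred // p1 divn1.
- by move=> z /=; rewrite in_classes_lifts.
- exact: lifts_uniq.
- by move=> y _; exists (y %% L); rewrite ?ltn_pmod //= modn_dvdm.
- move=> m; rewrite mem_block => /and3P[_ mpA mA]; split=> //.
    exact: dvdn_gt0 mpA.
  move=> _ _ /mem_lifts[i ip ->] /mem_lifts[j jp ->].
  by move/(lifts_separated pp mpA mA ip jp) ->.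
move=> Z' _ _; rewrite size_lifts sizeb.
rewrite p1; case: Z' => [|y []] // _; rewrite -(IHcs (p * A) pA0 y) //.
by congr size; apply: eq_irr_covers => z; rewrite /= /in_classes /= orbF.
Qed.

(** * The Chinese remainder grid above one class *)

Lemma eqn_mod_lift p A x k i : 0 < A ->
  (x + k * A == x + i * A %[mod p * A]) = (k == i %[mod p]).
Proof. by move=> A0; rewrite eqn_modDl -!muln_modl eqn_pmul2r. Qed.

(* The points lying above both an (x + i A) mod q A and an (x + j A) mod P A. *)
Section Grid.
Variables (A x q P : nat).
Hypotheses (A0 : 0 < A) (pq : prime q) (pP : prime P) (qP : q != P).

Let cqP : coprime q P.
Proof. by rewrite prime_coprime // dvdn_prime2. Qed.

(** The quotients recover the indices of the two lifts, and their Chinese remainder is the index of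
    the common point. *)
Definition grid (y1 y2 : nat) : nat :=
  x + chinese q P ((y1 - x) %/ A) ((y2 - x) %/ A) * A.

Lemma grid_modl y1 y2 : y1 \in lifts x A q -> grid y1 y2 = y1 %[mod q * A].
Proof.
case/mem_lifts=> i _ ->; apply/eqP; rewrite eqn_mod_lift // addKn mulnK //.
by rewrite chinese_modl.
Qed.

Lemma grid_modr y1 y2 : y2 \in lifts x A P -> grid y1 y2 = y2 %[mod P * A].
Proof.
case/mem_lifts=> i _ ->; apply/eqP; rewrite eqn_mod_lift // addKn mulnK //.
by rewrite chinese_modr.
Qed.

Lemma in_classes_grid Z1 Z2 z :
    {subset Z1 <= lifts x A q} -> {subset Z2 <= lifts x A P} ->
  in_classes (P * (q * A)) [seq grid y1 y2 | y1 <- Z1, y2 <- Z2] z =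
  in_classes (q * A) Z1 z && in_classes (P * A) Z2 z.
Proof.
move=> sub1 sub2.
have d1 : q * A %| P * (q * A) by rewrite dvdn_mull.
have d2 : P * A %| P * (q * A) by rewrite mulnCA dvdn_mull.
apply/hasP/andP.
  case=> _ /allpairsP[[y1 y2] /= [y1Z y2Z ->]] /eqP zy; split; apply/hasP.
    exists y1 => //; rewrite -(grid_modl y2 (sub1 _ y1Z)).
    by move/(congr1 (modn^~ (q * A))): zy; rewrite !modn_dvdm // => ->.
  exists y2 => //; rewrite -(grid_modr y1 (sub2 _ y2Z)).
  move/(congr1 (modn^~ (P * A))): zy.
  by rewrite !modn_dvdm // => ->.
case=> /hasP[y1 y1Z zy1] /hasP[y2 y2Z zy2].
exists (grid y1 y2); first by apply/allpairsP; exists (y1, y2).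
have zx : z = x %[mod A].
  move/mem_lifts: (sub1 _ y1Z) zy1 => [i _ ->] /eqP/(congr1 (modn^~ A)).
  by rewrite !modn_dvdm ?dvdn_mull // => ->; rewrite -modnDmr modnMl addn0.
have [k _ zk] : exists2 k, k < q * P & z = x + k * A %[mod q * P * A].
  by apply: lift_of_class; rewrite // muln_gt0 !prime_gt0.
rewrite mulnA (mulnC P) zk eqn_mod_lift // chinese_remainder // chinese_modl //.
rewrite chinese_modr //.
have zkm N : N %| q * P * A -> z = x + k * A %[mod N].
  by move=> NL; move/(congr1 (modn^~ N)): zk; rewrite !modn_dvdm.
move: zy1 zy2; rewrite !zkm; last 2 first.
- by rewrite -mulnA dvdn_mull.
- by rewrite -mulnA mulnCA dvdn_mull.
have /mem_lifts[i _ ->] := sub1 _ y1Z; have /mem_lifts[j _ ->] := sub2 _ y2Z.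
rewrite !eqn_mod_lift // => /eqP ki /eqP kj.
by rewrite !addKn !mulnK // ki kj !eqxx.
Qed.

(** If [m] divides [k * A], then [q] divides [k], since otherwise [m] would divide [P * A];
    symmetrically [P] divides [k]. So congruent points have indices that agree modulo both
    primes. *)
Lemma grid_separated m : m %| P * (q * A) -> ~~ (m %| q * A) ->
    ~~ (m %| P * A) ->
  {in lifts x A q &, forall y1 y1', {in lifts x A P &, forall y2 y2',
     grid y1 y2 = grid y1' y2' %[mod m] -> y1 = y1' /\ y2 = y2'}}.
Proof.
move=> mL mqA mPA y1 y1' y1l y1'l y2 y2' y2l y2'l e.
have diff k k' : k <= k' -> x + k * A = x + k' * A %[mod m] ->
    (k == k' %[mod q]) && (k == k' %[mod P]).
  move=> kk' /esym/eqP; rewrite eqn_mod_dvd ?leq_add2l ?leq_mul //.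
  rewrite subnDl -mulnBl => md; rewrite ![k == _ %[mod _]]eq_sym.
  rewrite !eqn_mod_dvd //; apply/andP; split.
    apply: contraNT mPA; apply: dvdn_cancel_prime => //; first by rewrite mulnCA.
    by rewrite mulnCA dvdn_mull.
  apply: contraNT mqA; apply: dvdn_cancel_prime => //.
  by rewrite mulnCA dvdn_mull.
have {e} /andP[/eqP eq1 /eqP eq2] :
    (chinese q P ((y1 - x) %/ A) ((y2 - x) %/ A) ==
     chinese q P ((y1' - x) %/ A) ((y2' - x) %/ A) %[mod q]) &&
    (chinese q P ((y1 - x) %/ A) ((y2 - x) %/ A) ==
     chinese q P ((y1' - x) %/ A) ((y2' - x) %/ A) %[mod P]).
  have [le|/ltnW le] := leqP (chinese q P ((y1 - x) %/ A) ((y2 - x) %/ A))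
                       (chinese q P ((y1' - x) %/ A) ((y2' - x) %/ A)).
    exact: diff.
  by rewrite ![_ == chinese _ _ ((y1' - _) %/ _) _ %[mod _]]eq_sym; apply: diff.
move: eq1 eq2; rewrite !chinese_modl // !chinese_modr //.
have /mem_lifts[i iq ->] := y1l; have /mem_lifts[i' i'q ->] := y1'l.
have /mem_lifts[j jP ->] := y2l; have /mem_lifts[j' j'P ->] := y2'l.
by rewrite !addKn !mulnK // !modn_small // => -> ->.
Qed.

End Grid.

(** * The last three rounds of choices *)

(** The first two blocks leave some lifts by [q] and some by [P], that is, a grid of [n] classes
    modulo [L]. Each modulus in [R] removes one grid class, so everything gets covered only if
    [n <= size R]; the boolean factor records this. *)
Lemma size_irr_covers_last L A q P M x :
    prime q -> prime P -> q != P -> 0 < A -> L = P * (q * A) ->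
    (forall m, m \in M -> m %| L) -> size (block M A (q * A)) < q ->
  let R := [seq m <- M | ~~ (m %| q * A) && ~~ (m %| P * A)] in
  let n := (q - size (block M A (q * A))) * (P - size (block M A (P * A))) in
  size (irr_covers L (block M A (q * A) ++ block M A (P * A) ++ R)
          [pred z | z == x %[mod A]]) =
    q ^_ size (block M A (q * A)) * (P ^_ size (block M A (P * A)) *
      (n ^_ size R * (n <= size R))).
Proof.
move=> pq pP qP A0 LE ML szq R n.
have [q0 P0] := (prime_gt0 pq, prime_gt0 pP).
have L0 : 0 < L by rewrite LE !muln_gt0 q0 P0.
have qAL : q * A %| L by rewrite LE dvdn_mull.
have PAL : P * A %| L by rewrite LE mulnCA dvdn_mull.
rewrite -[X in X ^_ size (block _ _ (q * A))](size_lifts x A q).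
apply: (size_irr_covers_separated (N := q * A) (V := predT) (Z := lifts x A q))
  => [z||y _|m|Z1 sub1 uZ1 sZ1].
- by rewrite /= in_classes_lifts.
- exact: lifts_uniq.
- by exists (y %% L); rewrite ?ltn_pmod //= modn_dvdm.
- rewrite mem_block => /and3P[_ mqA mA]; split=> //.
    by apply: dvdn_gt0 mqA; rewrite muln_gt0 q0.
  move=> _ _ /mem_lifts[i ip ->] /mem_lifts[j jp ->].
  by move/(lifts_separated pq mqA mA ip jp) ->.
rewrite size_lifts in sZ1.
rewrite -[X in X ^_ size (block _ _ (P * A))](size_lifts x A P).
apply: (size_irr_covers_separated (N := P * A) (V := in_classes (q * A) Z1)
  (Z := lifts x A P)) => [z||y yl|m|Z2 sub2 uZ2 sZ2].
- rewrite /= in_classes_lifts //; case zZ1: (in_classes _ _ _) => //=.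
  apply/esym; rewrite -(in_classes_lifts x A z q0).
  by case/hasP: zZ1 => y /sub1 yl zy; apply/hasP; exists y.
- exact: lifts_uniq.
(* Fewer than [q] moduli leave some lift by [q]; the grid point above it and [y] is the witness. *)
- have [y1 y1Z] : exists y1, y1 \in Z1.
    case: (Z1) sZ1 szq => [|y1 Z1' _ _]; last by exists y1; rewrite mem_head.
    by move/eqP; rewrite eq_sym subn_eq0 leqNgt => /negPf->.
  exists (grid A x q P y1 y %% L); rewrite ?ltn_pmod //.
  rewrite /= modn_dvdm // (grid_modr A0 pq pP qP y1 yl) eqxx andbT.
  apply/hasP; exists y1 => //.
  by rewrite modn_dvdm // (grid_modl A0 pq pP qP y (sub1 _ y1Z)).
- rewrite mem_block => /and3P[_ mPA mA]; split=> //.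
    by apply: dvdn_gt0 mPA; rewrite muln_gt0 P0.
  move=> _ _ /mem_lifts[i ip ->] /mem_lifts[j jp ->].
  by move/(lifts_separated pP mPA mA ip jp) ->.
rewrite size_lifts in sZ2.
have sZ : size [seq grid A x q P y1 y2 | y1 <- Z1, y2 <- Z2] = n.
  by rewrite size_allpairs sZ1 sZ2.
rewrite -[X in irr_covers _ X _](cats0 R) -[X in X ^_ size R]sZ.
have sepR m : m \in R -> [/\ m %| P * (q * A), ~~ (m %| q * A) & ~~ (m %| P * A)].
  by rewrite mem_filter => /andP[/andP[-> ->] /ML]; rewrite LE.
apply: (size_irr_covers_separated (N := P * (q * A)) (V := predT)
  (Z := [seq grid A x q P y1 y2 | y1 <- Z1, y2 <- Z2]))
  => [z||y _|m /sepR[mL mqA mPA]|Z3 _ _ sZ3].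
- by rewrite [RHS]/= in_classes_grid.
- apply: allpairs_uniq => // [[y1 y2] [y1' y2']] /=.
  case/allpairsP=> [[? ?] /= [a b [-> ->]]].
  case/allpairsP=> [[? ?] /= [a' b' [-> ->]]] e.
  (* Injectivity of the grid is separation for the full modulus [P * (q * A)]. *)
  have [|||-> ->//] := grid_separated A0 pq pP qP (dvdnn _) _ _
    (sub1 _ a) (sub1 _ a') (sub2 _ b) (sub2 _ b').
  - by rewrite gtnNdvd // ?muln_gt0 ?q0 // ltn_Pmull ?prime_gt1 // muln_gt0 q0.
  - by rewrite mulnCA gtnNdvd // ?muln_gt0 ?P0 // ltn_Pmull ?prime_gt1 // muln_gt0 P0.
  - by rewrite e.
- by exists (y %% L); rewrite ?ltn_pmod //= LE modn_mod.
- split=> //; first by apply: dvdn_gt0 mL; rewrite -LE.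
  move=> _ _ /allpairsP[[y1 y2] /= [a b ->]] /allpairsP[[y1' y2'] /= [a' b' ->]].
  move/(grid_separated A0 pq pP qP mL mqA mPA).
  by case=> // [||||-> ->]; rewrite ?sub1 ?sub2.
rewrite sZ in sZ3 *; rewrite /=.
(* With no moduli left, the empty list is the only continuation if no class remains, and there is
   none otherwise. *)
rewrite -subn_eq0 -sZ3; case: Z3 {sZ3} => [|y Z3] /=.
  by case: ifP => // /hasP[].
case: ifP => // /negbT/hasPn/(_ (y %% L)).
by rewrite mem_iota ltn_pmod // /= /in_classes /= LE modn_mod eqxx => /(_ isT).
Qed.

(** * Divisor counts *)

Lemma prod_nseq b q : \prod_(p <- nseq b q) p = q ^ b.
Proof. by elim: b => [|b IHb]; rewrite ?big_nil // big_cons IHb expnS. Qed.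

Definition tau (n : nat) : nat := size (divisors n).

Lemma size_divisors_sub (s : seq nat) n :
  0 < n -> uniq s -> (forall d, d \in s -> d %| n) -> size s <= tau n.
Proof.
by move=> n0 us sn; apply: uniq_leq_size => // d /sn; rewrite -dvdn_divisors.
Qed.

(** The part of [m] prime to [q] divides [B], so only the exponent of [q] in [m] decides. *)
Lemma dvdn_prime_power_top q b B m : prime q -> coprime q B ->
    m %| q ^ b.+1 * B -> (q ^ b.+1 %| m) = ~~ (m %| q ^ b * B).
Proof.
move=> pq cqB mB; have q0 := prime_gt0 pq; apply/idP/idP=> [qm|].
  apply/negP => /(dvdn_trans qm); rewrite expnSr dvdn_pmul2l ?expn_gt0 ?q0 //.
  by apply/negP; rewrite -prime_coprime.
apply: contraR => qm; case: (posnP m) mB qm => [->|m0] mB qm; first by rewrite dvdn0 in qm.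
have [e qe me] := pfactor_coprime pq m0.
move: mB qm; rewrite me; set t := logn q m => mB qm.
have tb : t <= b.
  by rewrite leqNgt; apply: contraNN qm => bt; rewrite dvdn_mull // dvdn_exp2l.
rewrite mulnC dvdn_mul ?dvdn_exp2l //.
have : e %| q ^ b.+1 * B by apply: dvdn_trans mB; rewrite dvdn_mulr.
by rewrite Gauss_dvdr // coprimeXr // coprime_sym.
Qed.

(** A divisor of [p ^ s.+1 * A] either divides [p ^ s * A] or is [p ^ s.+1] times a divisor of
    [A]. *)
Lemma tau_prime_mul p s A : prime p -> 0 < A -> coprime p A ->
  tau (p ^ s.+1 * A) = tau (p ^ s * A) + tau A.
Proof.
move=> pp A0 cpA; have p0 := prime_gt0 pp.
rewrite /tau -(size_map (muln (p ^ s.+1)) (divisors A)) -size_cat.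
apply: perm_size; apply: uniq_perm; first exact: divisors_uniq.
  rewrite cat_uniq divisors_uniq map_inj_uniq ?divisors_uniq ?andbT /=.
    apply/hasPn => _ /mapP[d _ ->]; rewrite -dvdn_divisors ?muln_gt0 ?expn_gt0 ?p0 //.
    apply/negP => /(dvdn_trans (dvdn_mulr d (dvdnn _))).
    rewrite expnSr dvdn_pmul2l ?expn_gt0 ?p0 // => pA.
    by move: cpA; rewrite prime_coprime // pA.
  by move=> d d' /eqP; rewrite eqn_pmul2l ?expn_gt0 ?p0 // => /eqP.
move=> d; rewrite mem_cat -!dvdn_divisors ?muln_gt0 ?expn_gt0 ?p0 //.
apply/idP/orP => [dA|[dA|/mapP[e]]].
- have [/dvdnP[e de]|pd] := boolP (p ^ s.+1 %| d).
    right; apply/mapP; exists e; last by rewrite mulnC.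
    by move: dA; rewrite de mulnC dvdn_pmul2l ?expn_gt0 ?p0 // dvdn_divisors.
  by left; move: pd; rewrite (dvdn_prime_power_top pp cpA dA) negbK.
- by apply: dvdn_trans dA _; rewrite dvdn_mul ?dvdn_exp2l.
- rewrite -dvdn_divisors // => eA ->; exact: dvdn_mul.
Qed.

Lemma tau_expn_mul p s A : prime p -> 0 < A -> coprime p A ->
  tau (p ^ s * A) = s.+1 * tau A.
Proof.
move=> pp A0 cpA; elim: s => [|s IHs]; first by rewrite !mul1n.
by rewrite tau_prime_mul // IHs mulSn addnC.
Qed.

(** Growth by [p.-1] leaves fewer new moduli than the [p] lifts of a class, so an uncovered class
    keeps an uncovered lift. *)
Fixpoint tau_chain (A : nat) (cs : seq nat) : bool :=
  if cs is p :: cs' then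
    [&& prime p, tau (p * A) == tau A + p.-1 & tau_chain (p * A) cs']
  else true.

Lemma tau_chain_cat A cs cs' : tau_chain A (cs ++ cs') =
  tau_chain A cs && tau_chain (A * \prod_(p <- cs) p) cs'.
Proof.
elim: cs A => [|p cs IHcs] A /=; first by rewrite big_nil muln1.
by rewrite IHcs big_cons (mulnC p A) mulnA -!andbA.
Qed.

Lemma chain_full_cat M A cs cs' : chain_full M A (cs ++ cs') =
  chain_full M A cs && chain_full M (A * \prod_(p <- cs) p) cs'.
Proof.
elim: cs A => [|p cs IHcs] A /=; first by rewrite big_nil muln1.
by rewrite IHcs big_cons (mulnC p A) mulnA -!andbA.
Qed.

Lemma tau_chain_nseq q s b E : prime q -> 0 < E -> coprime q E ->
  tau E = q.-1 -> tau_chain (q ^ s * E) (nseq b q).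
Proof.
move=> pq E0 cqE tauE; elim: b s => //= b IHb s.
by rewrite mulnA -expnS IHb tau_prime_mul // tauE eqxx pq.
Qed.

Lemma tau_chain_prime A cs : tau_chain A cs -> all prime cs.
Proof. by elim: cs A => //= p cs IHcs A /and3P[-> _ /IHcs]. Qed.

(** * Points left uncovered by the moduli dividing a partial product *)

Section Uncovered.
Variables (M : seq nat) (res : nat -> nat).
Hypothesis uM : uniq M.

Definition uncovered (D z : nat) : bool :=
  all (fun m => (m %| D) ==> (z != res m %[mod m])) M.

Lemma size_block A p : 0 < p -> 0 < A -> tau (p * A) = tau A + p.-1 ->
  size (block M A (p * A)) <= p.-1.
Proof.
move=> p0 A0 tauA; rewrite -(leq_add2l (tau A)) -tauA /tau -size_cat.
apply: size_divisors_sub; first by rewrite muln_gt0 p0.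
  rewrite cat_uniq divisors_uniq filter_uniq // andbT /=.
  apply/hasPn=> m; rewrite mem_block => /and3P[_ _].
  by rewrite -dvdn_divisors.
move=> d; rewrite mem_cat -dvdn_divisors // => /orP[dA|].
  exact: dvdn_mull.
by rewrite mem_block => /and3P[].
Qed.

(** Each covered lift is charged to a modulus hitting it. This modulus lies in the block because [z]
    is uncovered, and it hits no other lift. The list [T] may omit moduli known to miss all
    lifts. *)
Lemma count_uncovered_lifts A p z (T : seq nat) : prime p -> uncovered A z ->
    (forall m i, m \in block M A (p * A) -> i < p ->
       z + i * A = res m %[mod m] -> m \in T) ->
  p <= size T + count (fun i => uncovered (p * A) (z + i * A)) (iota 0 p).
Proof.
move=> pp unc hitT; set a := fun i => _.
rewrite -[X in X <= _](size_iota 0 p) -(count_predC a) addnC leq_add2r.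
pose hit i m := (m \in block M A (p * A)) && (z + i * A == res m %[mod m]).
(* The default 0 does not occur at a covered lift. *)
pose f i := nth 0 M (find (hit i) M).
have fP i : ~~ a i -> hit i (f i).
  case/allPn=> m mM; rewrite negb_imply negbK => /andP[mpA mz].
  apply: nth_find; apply/hasP; exists m => //; rewrite /hit mz andbT.
  rewrite mem_block mM mpA /=; apply/negP=> mA.
  move/allP/(_ m mM): unc; rewrite mA /=; case/negP; move: mz.
  by case/dvdnP: mA => k ->; rewrite mulnA -modnDmr modnMl addn0.
rewrite -size_filter -(size_map f); apply: uniq_leq_size.
  rewrite map_inj_in_uniq ?filter_uniq ?iota_uniq // => i j.
  rewrite !mem_filter !mem_iota /= !add0n => /andP[ai ip] /andP[aj jp] fij.
  have /andP[] := fP i ai; rewrite mem_block => /and3P[_ mpA mA] /eqP ei.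
  have /andP[_ /eqP ej] := fP j aj.
  apply: (lifts_separated (x := z) pp mpA mA ip jp); rewrite ei fij.
  by rewrite ej.
move=> m /mapP[i]; rewrite mem_filter mem_iota /= add0n => /andP[ai ip] ->.
have /andP[fi /eqP zi] := fP i ai; exact: hitT zi.
Qed.

Lemma uncovered_lift A p z : prime p -> 0 < A -> tau (p * A) = tau A + p.-1 ->
  uncovered A z -> exists2 i, i < p & uncovered (p * A) (z + i * A).
Proof.
move=> pp A0 tauA unc; have p0 := prime_gt0 pp.
have := count_uncovered_lifts (T := block M A (p * A)) pp unc (fun m _ h _ _ => h).
have := size_block p0 A0 tauA; set c := count _ _ => sb pc.
have : 0 < c by lia.
by rewrite -has_count => /hasP[i]; rewrite mem_iota /= => ip; exists i.
Qed.

Lemma uncovered_extend A cs z : 0 < A -> tau_chain A cs -> uncovered A z ->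
  exists2 z', z' = z %[mod A] & uncovered (A * \prod_(p <- cs) p) z'.
Proof.
elim: cs A z => [|p cs IHcs] A z A0 /=.
  by move=> _ unc; exists z => //; rewrite big_nil muln1.
case/and3P=> pp /eqP tauA tcs unc.
have [i _ unci] := uncovered_lift pp A0 tauA unc.
have pA0 : 0 < p * A by rewrite muln_gt0 prime_gt0.
have [z' ez' uncz'] := IHcs _ _ pA0 tcs unci.
exists z'; last by rewrite big_cons mulnA (mulnC A).
move/(congr1 (modn^~ A)): ez'; rewrite !modn_dvdm 1?dvdn_mull // => ->.
by rewrite -modnDmr modnMl addn0.
Qed.

Lemma uncovered_two_lifts A p z (T : seq nat) : prime p -> 0 < A -> uncovered A z ->
    (forall m i, m \in block M A (p * A) -> i < p ->
       z + i * A = res m %[mod m] -> m \in T) -> size T < p.-1 ->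
  exists z1 z2, [/\ z1 = z2 %[mod A], z1 != z2 %[mod p * A],
     uncovered (p * A) z1 & uncovered (p * A) z2].
Proof.
move=> pp A0 unc hitT szT; have := count_uncovered_lifts pp unc hitT.
rewrite -size_filter; case E : [seq i <- _ | _] => [|i [|j s]] /= lep;
  [exfalso; lia | exfalso; lia |].
have /andP[+ _] : uniq [:: i, j & s] by rewrite -E filter_uniq ?iota_uniq.
rewrite inE negb_or => /andP[ij _].
have : i \in [:: i, j & s] by rewrite mem_head.
have : j \in [:: i, j & s] by rewrite !inE eqxx orbT.
rewrite -E !mem_filter !mem_iota /= !add0n => /andP[uj jp] /andP[ui ip].
exists (z + i * A), (z + j * A); split=> //.
  by rewrite -modnDmr modnMl -[RHS]modnDmr modnMl.
by rewrite eqn_mod_lift // !modn_small.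
Qed.

(** At the first deficient block two lifts survive. Both extend to the end of the chain and stay
    distinct, as they already differ modulo [p * A]. *)
Lemma uncovered_split A cs z : 0 < A -> tau_chain A cs -> uncovered A z ->
    ~~ chain_full M A cs ->
  exists z1 z2, [/\ z1 != z2 %[mod A * \prod_(p <- cs) p],
     uncovered (A * \prod_(p <- cs) p) z1
   & uncovered (A * \prod_(p <- cs) p) z2].
Proof.
elim: cs A z => [|p cs IHcs] A z A0 //=.
case/and3P=> pp /eqP tauA tcs unc; rewrite big_cons mulnA (mulnC A).
have pA0 : 0 < p * A by rewrite muln_gt0 prime_gt0.
have [_ /= nfull|neq _] := eqVneq (size (block M A (p * A))) p.-1.
  have [i _ unci] := uncovered_lift pp A0 tauA unc.
  exact: (IHcs _ _ pA0 tcs unci nfull).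
have sb : size (block M A (p * A)) < p.-1.
  by rewrite ltn_neqAle neq size_block // prime_gt0.
have [z1 [z2 [_ neqz unc1 unc2]]] := 
  uncovered_two_lifts pp A0 unc (fun m _ h _ _ => h) sb.
have [z1' e1 unc1'] := uncovered_extend pA0 tcs unc1.
have [z2' e2 unc2'] := uncovered_extend pA0 tcs unc2.
exists z1', z2'; split=> //; apply: contraNN neqz => /eqP.
move/(congr1 (modn^~ (p * A))); rewrite !modn_dvdm 1?dvdn_mulr // e1 e2.
by move=> ->.
Qed.

(** * Two uncovered points force many divisors *)

Lemma count_fibers (a : pred nat) (g : nat -> nat) P (D : seq nat) :
  \sum_(b < P) count (fun d => a d && (g d == b)) D <= count a D.
Proof.
elim: D => [|d D IHD] /=; first by rewrite big1.
rewrite big_split leq_add //=.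
case: (a d) => /=; last by rewrite big1.
have [gP|gP] := ltnP (g d) P.
  rewrite (bigD1 (Ordinal gP)) //= eqxx big1 // => b.
  by rewrite -val_eqE /= eq_sym => /negPf->.
rewrite big1 // => b _; apply/eqP; rewrite eqb0.
by apply: contraL (ltn_ord b) => /eqP <-; rewrite -leqNgt.
Qed.

(** For each [b] modulo [P], the points that are [b] modulo [P] and [y1] or [y2] modulo [A] need
    moduli [P * d] with residue [b] modulo [P]. Either two different [d] serve them, or a single [d]
    dividing [y1 - y2] serves both and is counted twice. Summing over [b] gives the bound. *)
Lemma uncovered_pair_bound A P y1 y2 : prime P -> 0 < A -> coprime P A ->
    (forall m, m \in M -> m %| P * A) ->
    (forall z, exists2 m, m \in M & z = res m %[mod m]) ->
    uncovered A y1 -> uncovered A y2 ->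
  2 * P <= tau A + count (fun d => y1 == y2 %[mod d]) (divisors A).
Proof.
move=> pP A0 cPA ML cov unc1 unc2.
pose a d := P * d \in M; pose g d := res (P * d) %% P.
pose e d := y1 == y2 %[mod d].
have {cov} hit b y : b < P -> uncovered A y ->
    exists d, [/\ d %| A, a d && (g d == b) & y = res (P * d) %[mod d]].
  move=> bP unc; have [m mM em] := cov (chinese P A b y).
  (* A modulus not divisible by [P] divides [A] and would already cover [y]. *)
  have Pm : P %| m.
    apply/negPn/negP=> Pm; have mA : m %| A.
      by have := ML m mM; rewrite Gauss_dvdr // coprime_sym prime_coprime.
    move/allP/(_ m mM): unc; rewrite mA -em /=; case/negP; apply/eqP.
    have /(congr1 (modn^~ m)) := chinese_modr cPA b y.
    by rewrite !modn_dvdm.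
  have /dvdnP[d] := Pm; rewrite mulnC => dm; subst m.
  have dA : d %| A by move/ML: mM; rewrite dvdn_pmul2l ?prime_gt0.
  exists d; split=> //.
    rewrite /a mM /g; have /(congr1 (modn^~ P)) := em.
    by rewrite !modn_dvdm // => <-; rewrite chinese_modl // modn_small ?eqxx.
  have /(congr1 (modn^~ d)) := em; rewrite !modn_dvdm 1?dvdn_mull // => <-.
  have /(congr1 (modn^~ d)) := chinese_modr cPA b y.
  by rewrite !modn_dvdm.
have two b : b < P ->
    2 <= count (fun d => a d && (g d == b)) (divisors A)
       + count (fun d => (a d && e d) && (g d == b)) (divisors A).
  move=> bP; have [d1 [d1A ad1 e1]] := hit b y1 bP unc1.
  have [d2 [d2A ad2 e2]] := hit b y2 bP unc2.
  rewrite -!size_filter; have [e12|d12] := eqVneq d1 d2.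
    subst d2; rewrite -[2]/(1 + 1) leq_add // -has_predT; apply/hasP;
      exists d1; rewrite // mem_filter -dvdn_divisors // d1A andbT //.
    case/andP: ad1 => -> ->; rewrite /= andbT /e e1 -e2 //.
  apply: leq_trans (leq_addr _ _); apply: (@uniq_leq_size _ [:: d1; d2]).
    by rewrite /= inE d12.
  by move=> d; rewrite !inE => /orP[]/eqP->;
    rewrite mem_filter -dvdn_divisors // ?ad1 ?ad2.
have -> : 2 * P = \sum_(b < P) 2 by rewrite sum_nat_const card_ord mulnC.
apply: (@leq_trans (\sum_(b < P) (count (fun d => a d && (g d == b)) (divisors A)
   + count (fun d => (a d && e d) && (g d == b)) (divisors A)))).
  by apply: leq_sum => b _; exact: two.
rewrite big_split leq_add //=.
  by apply: leq_trans (count_fibers _ _ _ _) (count_size _ _).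
apply: leq_trans (count_fibers _ _ _ _) _.
by apply: sub_count => d /andP[].
Qed.

(** The difference is [k * (q ^ s * E)] with [q] not dividing [k], so its common divisors with
    [q ^ a * E] divide [q ^ s * E]. *)
Lemma common_divisors_bound E q s a y1 y2 : prime q -> 0 < E -> s < a ->
    y1 = y2 %[mod q ^ s * E] -> y1 != y2 %[mod q ^ s.+1 * E] ->
  count (fun d => y1 == y2 %[mod d]) (divisors (q ^ a * E)) <= tau (q ^ s * E).
Proof.
move=> pq E0 sa.
have B0 b : 0 < q ^ b * E by rewrite muln_gt0 expn_gt0 (prime_gt0 pq).
wlog le21 : y1 y2 / y2 <= y1 => [hw e ne|].
  have [/hw|/ltnW/hw] := leqP y2 y1; first exact.
  by under eq_count do rewrite eq_sym; apply; rewrite // eq_sym.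
move/eqP; rewrite !eqn_mod_dvd // => /dvdnP[k ek].
rewrite ek expnS -mulnA dvdn_pmul2r // => qk.
rewrite -size_filter; apply: size_divisors_sub; rewrite ?filter_uniq ?divisors_uniq //.
move=> d; rewrite mem_filter -dvdn_divisors //.
rewrite eqn_mod_dvd // ek -(subnK (ltnW sa)) expnD -mulnA => /andP[dk dq].
have /eqP ckq : coprime k (q ^ (a - s)).
  by rewrite coprimeXr // coprime_sym prime_coprime.
by rewrite -[q ^ s * E]mul1n -ckq muln_gcdl dvdn_gcd dk.
Qed.

(** * Fullness of the blocks before the last factor [q] *)

(** A deficient block yields two uncovered points first separated at some level [s] of the powers of
    [q], so [2 * P <= (a + s).+2 * q.-1]. For [s = 0] this contradicts [a.+2 * q.-1 < 2 * P], and
    for [s <= a - 2] it contradicts [a * q.-1 < P]. Level [a - 1] is out of reach, hence only [a.-1]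
    factors [q]. *)
Lemma covering_chain_full cs q a P :
    let E := \prod_(p <- cs) p in
    prime q -> prime P -> 0 < E -> coprime q E -> coprime P (q ^ a * E) ->
    tau_chain 1 cs -> tau E = q.-1 -> 0 < a -> a * q.-1 < P ->
    a.+2 * q.-1 < 2 * P ->
    (forall m, m \in M -> 1 < m /\ m %| P * (q ^ a * E)) ->
    (forall z, exists2 m, m \in M & z = res m %[mod m]) ->
  chain_full M 1 (cs ++ nseq a.-1 q).
Proof.
move=> E pq pP E0 cqE cPA tcs tauE a0 aP aP' MP cov.
have ML m : m \in M -> m %| P * (q ^ a * E) by case/MP.
have A0 b : 0 < q ^ b * E by rewrite muln_gt0 expn_gt0 (prime_gt0 pq).
have tauq b : tau (q ^ b * E) = b.+1 * q.-1 by rewrite tau_expn_mul // tauE.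
(* Both points extend to modulus [q ^ a * E] with their separation level kept, and the two bounds
   above combine there. *)
have nosplit s y1 y2 : s < a -> y1 = y2 %[mod q ^ s * E] ->
    y1 != y2 %[mod q ^ s.+1 * E] -> uncovered (q ^ s.+1 * E) y1 ->
    uncovered (q ^ s.+1 * E) y2 -> 2 * P <= (a + s).+2 * q.-1.
  move=> sa e12 ne12 unc1 unc2.
  have tq := tau_chain_nseq s.+1 (a - s.+1) pq E0 cqE tauE.
  have [y1' e1 {}unc1] := uncovered_extend (A0 _) tq unc1.
  have [y2' e2 {}unc2] := uncovered_extend (A0 _) tq unc2.
  move: unc1 unc2; rewrite prod_nseq mulnC mulnA -expnD subnK // => unc1 unc2.
  have le := uncovered_pair_bound pP (A0 a) cPA ML cov unc1 unc2.
  apply: leq_trans le _.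
  have -> : (a + s).+2 * q.-1 = tau (q ^ a * E) + tau (q ^ s * E).
    by rewrite !tauq -mulnDl addSn addnS.
  rewrite leq_add2l; apply: common_divisors_bound => //; last first.
    by rewrite e1 e2.
  have dv : q ^ s * E %| q ^ s.+1 * E by rewrite dvdn_mul // dvdn_exp2l.
  have /(congr1 (modn^~ (q ^ s * E))) := e1.
  have /(congr1 (modn^~ (q ^ s * E))) := e2.
  by rewrite !modn_dvdm // => -> ->.
have unc0 : uncovered 1 0.
  apply/allP=> m /MP[m1 _]; apply/implyP; rewrite dvdn1 => /eqP em.
  by rewrite em in m1.
rewrite chain_full_cat mul1n -/E; apply/andP; split.
  apply/negPn/negP => nfull.
  have [z1 [z2]] := uncovered_split (ltnSn 0) tcs unc0 nfull.
  rewrite mul1n -/E => -[ne12 unc1 unc2].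
  have qE0 : 0 < q * E by rewrite muln_gt0 prime_gt0.
  (* At the first step by q, the modulus q E cannot meet lifts of both z1 and
     z2, so one of them keeps two uncovered lifts. *)
  pose T := [seq m <- block M E (q * E) | m != q * E].
  (* [q * E] has [2 * q.-1] divisors; the [q.-1] divisors of [E] and [q * E] itself are not in
     [T]. *)
  have szT : size T < q.-1.
    rewrite -(ltn_add2l (tau E)) -addSn.
    have := tauq 1; rewrite mul2n -addnn -tauE expn1 => <-.
    rewrite /tau -[X in X <= _]/(size (q * E :: divisors E) + size T) -size_cat.
    apply: size_divisors_sub => //.
      rewrite cat_uniq filter_uniq ?filter_uniq //= divisors_uniq !andbT.
      rewrite -dvdn_divisors // gtnNdvd // ?ltn_Pmull ?prime_gt1 //=.
      apply/hasPn=> m; rewrite mem_filter mem_block inE => /andP[/negPf-> /and3P[_ _]].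
      by rewrite -dvdn_divisors.
    move=> d; rewrite mem_cat inE mem_filter mem_block -dvdn_divisors // -orbA.
    by case/or3P=> [/eqP->//|dE|/and4P[] //]; rewrite dvdn_mull.
  (* If [q * E] misses all lifts of [z], two of them stay uncovered, which is excluded at level
     0. *)
  have key z : uncovered E z ->
      (q * E \in M -> forall i, i < q -> z + i * E <> res (q * E) %[mod q * E]) ->
      False.
    move=> unc nhit.
    have [|w1 [w2 [ew new uw1 uw2]]] :=
      @uncovered_two_lifts E q z T pq E0 unc _ szT.
      move=> m i mb iq em; rewrite mem_filter mb andbT; apply/negP => /eqP mE.
      move: mb; rewrite mem_block mE => /andP[qEM _].
      by apply: (nhit qEM i iq); rewrite -mE.
    have := nosplit 0 w1 w2; rewrite expn1 expn0 mul1n addn0 => /(_ a0 ew new uw1 uw2).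
    by rewrite leqNgt aP'.
  (* So [q * E] hits lifts of both [z1] and [z2], and its residue is congruent to both modulo
     [E]. *)
  apply: (key z1 unc1) => qEM i iq ei; apply: (key z2 unc2) => _ j jq ej.
  case/negP: ne12; apply/eqP; move: ei; rewrite -ej.
  move/(congr1 (modn^~ E)); rewrite !modn_dvdm 1?dvdn_mull //.
  by rewrite -[X in X = _]modnDmr modnMl addn0 -[X in _ = X]modnDmr modnMl addn0.
have [z _] := uncovered_extend (ltnSn 0) tcs unc0; rewrite mul1n -/E => uncz.
suff full b s y : s + b = a.-1 -> uncovered (q ^ s * E) y ->
    chain_full M (q ^ s * E) (nseq b q).
  by have := full a.-1 0 z; rewrite expn0 mul1n; apply.
elim: b s y => //= b IHb s y sb unc; rewrite !mulnA -expnS.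
have tauS : tau (q * (q ^ s * E)) = tau (q ^ s * E) + q.-1.
  by rewrite mulnA -expnS tau_prime_mul // tauE.
apply/andP; split; last first.
  have [i _] := uncovered_lift pq (A0 s) tauS unc.
  by rewrite mulnA -expnS; apply: IHb; rewrite addSnnS.
apply/negPn/negP => neq.
have := size_block (prime_gt0 pq) (A0 s) tauS; rewrite leq_eqVlt mulnA -expnS.
rewrite (negPf neq) /= => lt.
have [|w1 [w2]] := @uncovered_two_lifts _ q y (block M (q ^ s * E) (q ^ s.+1 * E))
  pq (A0 s) unc _ lt; first by move=> m i; rewrite mulnA -expnS.
rewrite mulnA -expnS => -[ew new uw1 uw2].
(* From [s + b.+1 = a.-1] follows [s + 2 <= a], hence [(a + s).+2 <= 2 * a]. *)
have sa : s.+1 < a by clear -sb a0; lia.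
have := nosplit s w1 w2 (ltnW sa) ew new uw1 uw2.
rewrite leqNgt => /negP; apply; apply: leq_ltn_trans (_ : 2 * (a * q.-1) < _).
  by rewrite mulnA leq_mul2r; apply/orP; right; clear -sa; lia.
by rewrite ltn_pmul2l.
Qed.

End Uncovered.

(** * From coverings to lists of residues *)

Lemma covers_int (C : {fset nat * nat}) L : 0 < L ->
    (forall c, c \in C -> c.2 %| L) ->
  (forall z : int, exists2 c, c \in C & (z = c.1 %[mod c.2])%Z) <->
  (forall z, z < L -> exists2 c, c \in C & z = c.1 %[mod c.2]).
Proof.
move=> L0 CL; split=> [cov z _|cov z].
  by have [c cC] := cov (Posz z); rewrite !modz_nat => -[zc]; exists c.
have zL0 : (0 <= (z %% L)%Z)%R by rewrite modz_ge0 // -lt0n.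
have [|c cC ec] := cov `|(z %% L)%Z|%N.
  by rewrite -ltz_nat gez0_abs // ltz_pmod.
exists c => //; have /dvdnP[k Lk] := CL c cC.
have zE : z = ((z %/ L)%Z * Posz k * Posz c.2 + (z %% L)%Z)%R.
  by rewrite -mulrA -PoszM -Lk -divz_eq.
rewrite {1}zE modzMDl.
by rewrite -(gez0_abs zL0) !modz_nat ec.
Qed.

Lemma covering_residues (C : {fset nat * nat}) (M : {fset nat}) :
    is_covering C -> moduli C = M ->
  exists res, forall c, (c \in C) = (c.2 \in M) && (c.1 == res c.2).
Proof.
move=> [_ inj _] <-.
(* The default [(0, 0)] is read only at integers that are not moduli. *)
exists (fun m => (nth (0, 0) C (index m [seq c.2 | c <- C])).1) => c.
have nthE c' : c' \in C -> nth (0, 0) C (index c'.2 [seq c.2 | c <- C]) = c'.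
  move=> c'C; have cM : c'.2 \in [seq c.2 | c <- C] by apply/mapP; exists c'.
  have iC : index c'.2 [seq c.2 | c <- C] < size C.
    by rewrite -(size_map snd) index_mem.
  apply: inj; rewrite ?mem_nth //.
  by rewrite -(nth_map (0, 0) 0 snd) // nth_index.
apply/idP/andP=> [cC|[/imfsetP[c' /= c'C e2]]].
  by rewrite nthE // eqxx; split=> //; apply/imfsetP; exists c.
rewrite e2 nthE // => /eqP e1.
suff -> : c = c' by [].
by case: c e1 e2 => ? ? /= -> ->; case: c' {c'C}.
Qed.

(** Distinct moduli make [snd] injective on [C]; hence such cardinalities depend on [M] alone. *)
Lemma card_filter_moduli (C : {fset nat * nat}) (M : {fset nat}) (a : pred nat) :
    is_covering C -> moduli C = M ->
  #|` [fset c in C | a c.2]%fset| = count a M.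
Proof.
move=> cov eM; have [_ inj _] := cov.
rewrite -size_filter -(size_map snd); apply: perm_size; apply: uniq_perm.
- rewrite map_inj_in_uniq ?fset_uniq // => c c'.
  by rewrite !inE => /andP[cC _] /andP[c'C _]; apply: inj.
- by rewrite filter_uniq ?fset_uniq.
move=> m; rewrite mem_filter -eM; apply/mapP/andP => [[c]|[am /imfsetP[c /= cC em]]].
  by rewrite !inE => /andP[cC ac] ->; split=> //; apply/imfsetP; exists c.
by exists c => //; rewrite !inE cC /= -em.
Qed.

Lemma map_uniq_inj (T T' : eqType) (f : T -> T') (s : seq T) :
  uniq (map f s) -> {in s &, injective f}.
Proof.
elim: s => //= x s IHs /andP[fx us] y z; rewrite !inE.
case/predU1P=> [->|ys] /predU1P[->|zs] // e; last exact: IHs.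
  by case/negP: fx; apply/mapP; exists z.
by case/negP: fx; apply/mapP; exists y.
Qed.

Section CardGamma.
Variables (M : {fset nat}) (ms : seq nat) (L : nat).
Hypotheses (minM : minimal_moduli M) (ums : uniq ms) (msM : ms =i M).
Hypotheses (L0 : 0 < L) (ML : forall m, m \in M -> 1 < m /\ m %| L).

Let fset_of (s : seq (nat * nat)) : {fset nat * nat} := [fset c in s]%fset.

(** By minimality every pair of [C] covers some point alone, since otherwise deleting it would leave
    a covering. This is what [irr_covers_complete] asks for. *)
Lemma Gamma_irr_covers C :
  Gamma M C -> exists2 s, s \in irr_covers L ms predT & C = fset_of s.
Proof.
move=> GC; have [_ /(_ C GC)[cov irr]] := minM; have [_ modC] := GC.
have [res resE] := covering_residues cov modC.
have CL c : c \in C -> c.2 %| L by rewrite resE => /andP[/ML[]].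
have [C2 injC covC] := cov; have {}covC := (covers_int L0 CL).1 covC.
pose s := [seq (res m, m) | m <- ms].
have sC c : (c \in s) = (c \in C).
  rewrite resE -msM; apply/mapP/andP => [[m mms ->] //|[cms /eqP e1]].
  by exists c.2; rewrite // -e1; case: (c).
have snds : map snd s = ms by rewrite -map_comp map_id.
exists s; last by apply/fsetP=> c; rewrite inE /= sC.
rewrite -snds; apply: irr_covers_complete; rewrite ?snds //.
- by move=> c; rewrite sC => /C2[].
- move=> z zL _; have [c cC ec] := covC z zL; exists c; first by rewrite sC.
  by rewrite ec modn_small //; case: (C2 c cC).
move=> c; rewrite sC => cC.
pose alone z := (z %% c.2 == c.1) &&
  all (fun c' => (c' != c) ==> (z %% c'.2 != c'.1)) s.
have [/hasP[z]|none] := boolP (has alone (iota 0 L)).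
  rewrite mem_iota => zL /andP[zc /allP others]; exists z; split=> // c' c's.
  exact/implyP/others.
have DC : (C `\ c `<` C)%fset by rewrite fproperD1.
have DsubC c' : c' \in (C `\ c)%fset -> c' \in C by rewrite !inE => /andP[].
case: (irr _ DC); split.
- by move=> c' /DsubC/C2.
- by move=> c1 c2 /DsubC c1C /DsubC c2C; apply: injC.
apply/(covers_int L0) => [c' /DsubC/CL //|z zL].
have [c1 c1C e1] := covC z zL.
have [cc1|cc1] := eqVneq c1 c; last by exists c1; rewrite // !inE cc1.
subst c1.
have := hasPn none z; rewrite mem_iota => /(_ zL); rewrite /alone negb_and.
rewrite {1}e1 modn_small ?eqxx /=; last by case: (C2 _ cC).
case/allPn=> c2 c2s; rewrite negb_imply negbK => /andP[c21 /eqP e2].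
exists c2; first by rewrite !inE c21 -sC.
by rewrite e2 modn_small //; case: (C2 c2); rewrite // -sC.
Qed.

Lemma irr_covers_Gamma s : s \in irr_covers L ms predT -> Gamma M (fset_of s).
Proof.
case/irr_covers_sound=> snds slt cov; have mems c : c \in s -> c.2 \in M.
  by move=> cs; rewrite -msM -snds; apply/mapP; exists c.
split; last first.
  apply/fsetP=> m; rewrite -msM -snds; apply/imfsetP/mapP => -[c cs ->];
    by exists c; rewrite // ?inE /= in cs *.
split=> [c|c1 c2|].
- by rewrite inE /= => cs; split; [case: (ML (mems c cs)) | apply: slt].
- by rewrite !inE /=; apply: map_uniq_inj; rewrite snds.
apply/(covers_int L0) => [c|z zL]; first by rewrite inE /= => /mems/ML[].
have [c cs /eqP ec] := cov z zL isT; exists c; first by rewrite inE.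
by rewrite -ec modn_mod.
Qed.

(** With the order [ms] of the moduli fixed, a list is recovered from its underlying set. *)
Lemma card_Gamma :
  finite_set (Gamma M) /\ #|` fset_set (Gamma M)| = size (irr_covers L ms predT).
Proof.
pose F := [fset fset_of s | s in irr_covers L ms predT]%fset.
have -> : Gamma M = [set` F]%classic.
  apply/seteqP; split=> C /=.
    by case/Gamma_irr_covers=> s sin ->; apply/imfsetP; exists s.
  by case/imfsetP=> s /= sin ->; apply: irr_covers_Gamma.
split; first exact: finite_fset.
rewrite set_fsetK card_in_imfset /=; first by rewrite undup_id // irr_covers_uniq.
move=> s1 s2 s1in s2in e.
have [e1 _ _] := irr_covers_sound s1in; have [e2 _ _] := irr_covers_sound s2in.
have sz : size s1 = size s2 by rewrite -(size_map snd) e1 -e2 size_map.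
apply: (@eq_from_nth _ (0, 0)) => // i i1.
have i2 : i < size s2 by rewrite -sz.
have s12 c : c \in s1 -> c \in s2.
  by move/fsetP/(_ c): e; rewrite !inE /= => ->.
apply: (@map_uniq_inj _ _ snd s2).
- by rewrite e2.
- exact/s12/mem_nth.
- exact: mem_nth.
by rewrite -!(nth_map (0, 0) 0 snd) // e1 e2.
Qed.
End CardGamma.

(** * Factorization of the number of coverings *)

(** The moduli are taken in the order chain, [q]-block, [P]-block, [R]. As [Gamma M] is nonempty, no
    factor of the count vanishes; so the number of remaining classes equals [size R], and the last
    falling factorial is a factorial. *)
Lemma Gamma_factorization (M : {fset nat}) ds q P :
    let A := \prod_(p <- ds) p in
    let cp := size (block M A (q * A)) in
    let k := size (block M A (P * A)) in
    let R := [seq m <- M | ~~ (m %| q * A) && ~~ (m %| P * A)] in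
    minimal_moduli M -> all prime ds -> prime q -> prime P -> q != P ->
    (forall m, m \in M -> 1 < m /\ m %| P * (q * A)) ->
    chain_full M 1 ds -> cp < q ->
  [/\ finite_set (Gamma M), k <= P
    & #|` fset_set (Gamma M)| =
        \prod_(p <- ds) p`! * (q ^_ cp * (P ^_ k * (size R)`!))].
Proof.
move=> A cp k R minM pds pq pP qP ML full cpq.
have [q0 P0] := (prime_gt0 pq, prime_gt0 pP).
have A0 : 0 < A.
  by rewrite /A big_seq prodn_cond_gt0 // => x /(allP pds)/prime_gt0.
have qPA m : m %| q * A -> m %| P * A -> m %| A.
  by move=> mq mP; apply: (dvdn_cancel_prime pq mq mP); rewrite dvdn_prime2.
pose ms := chain_blocks M 1 ds ++ block M A (q * A) ++ block M A (P * A) ++ R.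
have ums : uniq ms.
  have uM := fset_uniq M.
  rewrite /ms !cat_uniq chain_blocks_uniq ?filter_uniq //= andbT.
  apply/and3P; split; apply/hasPn=> m; rewrite ?mem_cat.
  - rewrite /= mem_chain_blocks mul1n -/A !mem_block mem_filter.
    by case: (m %| A) (@dvdn_mull m q A) (@dvdn_mull m P A) => [->//->//|];
      rewrite ?andbF.
  - rewrite /= !mem_block mem_filter; apply: contraTN => /and3P[_ mq mA].
    by rewrite mq (contraNF (qPA m mq)) ?andbF.
  - by rewrite /= mem_block mem_filter => /andP[/andP[_ /negPf->]]; rewrite !andbF.
have msM : ms =i M.
  move=> m; rewrite !mem_cat mem_chain_blocks !mem_block mem_filter mul1n -/A.
  case mM: (m \in M) => /=; rewrite ?andbF //= dvdn1.
  have [m1 _] := ML m mM; rewrite (gtn_eqF m1) /=.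
  by case: (m %| A) => //=; case: (m %| q * A); case: (m %| P * A).
have L0 : 0 < P * (q * A) by rewrite !muln_gt0 P0 q0.
have [fin card] := card_Gamma minM ums msM L0 ML.
have Gamma_gt0 : 0 < #|` fset_set (Gamma M)|.
  have [[C GC] _] := minM; rewrite cardfs_gt0; apply/fset0Pn; exists C.
  by rewrite in_fset_set // inE.
have : #|` fset_set (Gamma M)| = \prod_(p <- ds) p`! * (q ^_ cp * (P ^_ k *
    (((q - cp) * (P - k)) ^_ size R * ((q - cp) * (P - k) <= size R)))).
  rewrite card /ms (@eq_irr_covers _ _ predT [pred z | z == 0 %[mod 1]]); last first.
    by move=> z; rewrite /= !modn1.
  apply: size_irr_covers_chain => // [|x]; rewrite mul1n -/A.
    by rewrite mulnA dvdn_mull.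
  by apply: size_irr_covers_last => // m /ML[].
move=> cardE; move: Gamma_gt0; rewrite cardE !muln_gt0 !ffact_gt0.
case/and5P=> _ _ kP Rn; rewrite lt0b => nR.
have nE : (q - cp) * (P - k) = size R by apply/eqP; rewrite eqn_leq nR.
by split=> //; rewrite nE leqnn ffactnn muln1.
Qed.

(** * Arithmetic of the numbers in the family *)

Lemma not_dvdn_prime_power q b B m : prime q -> 0 < B -> coprime q B ->
  m %| q ^ b * B -> ~~ (q ^ b.+1 %| m).
Proof.
move=> pq B0 cqB mB; apply/negP => /dvdn_trans/(_ mB).
rewrite expnSr dvdn_pmul2l ?expn_gt0 ?prime_gt0 //.
by apply/negP; rewrite -prime_coprime.
Qed.

Lemma dvdn_lcm_of (M : {fset nat}) m : m \in M -> m %| lcm_of M.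
Proof.
rewrite /lcm_of -[m \in M]/(m \in enum_fset M).
elim: (enum_fset M) => //= m' s IHs.
rewrite big_cons inE => /predU1P[->|/IHs ms]; first exact: dvdn_lcml.
exact: dvdn_trans (dvdn_lcmr _ _).
Qed.

Definition prime_chain (p alpha : nat -> nat) (t : nat) : seq nat :=
  \big[cat/[::]]_(1 <= u < t) nseq (alpha u) (p u).

Lemma prime_chainS p alpha t : 0 < t -> prime_chain p alpha t.+1 =
  prime_chain p alpha t ++ nseq (alpha t) (p t).
Proof. by move=> t0; rewrite /prime_chain big_nat_recr. Qed.

Lemma big_prime_chain (p alpha : nat -> nat) (F : nat -> nat) t : 0 < t ->
  \prod_(x <- prime_chain p alpha t) F x =
  \prod_(1 <= u < t) F (p u) ^ alpha u.
Proof.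
case: t => // t _; elim: t => [|t IHt].
  by rewrite /prime_chain !big_geq // big_nil.
rewrite prime_chainS // big_cat IHt [RHS]big_nat_recr //=; congr (_ * _).
by elim: (alpha _) => [|b IHb]; rewrite ?big_nil // big_cons IHb expnS.
Qed.

Lemma coprime_prime_powers (p alpha : nat -> nat) t x : prime x ->
    (forall u, 0 < u < t -> prime (p u) /\ p u != x) ->
  coprime x (\prod_(1 <= u < t) p u ^ alpha u).
Proof.
move=> px pu; rewrite big_nat_cond.
apply: (big_ind (coprime x)) => [|y z cy cz|u].
- exact: coprimen1.
- by rewrite coprimeMr cy.
rewrite andbT => /pu[pp ne].
by rewrite coprimeXr // prime_coprime // dvdn_prime2 // eq_sym.
Qed.

Section CalL.
Variables (n : nat) (p alpha : nat -> nat).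
Hypothesis pp : forall t, 1 <= t <= n.+2 -> prime (p t).
Hypothesis p1 : p 1 = 2.
Hypothesis p_incr : forall t, 1 <= t < n.+2 -> p t < p t.+1.
Hypothesis p_mod : forall t, 0 < t < n.+1 -> p t.+1 = 1 %[mod p t - 1].
Hypothesis alphaE : forall t, 1 <= t <= n ->
  alpha t = (p t.+1 - 1) %/ (p t - 1) - 1.

Lemma p_mono u t : 0 < u -> u < t -> t <= n.+2 -> p u < p t.
Proof.
move=> u0; elim: t => // t IHt; rewrite ltnS leq_eqVlt => /predU1P[<-|ut] tn.
  by apply: p_incr; rewrite u0.
apply: ltn_trans (IHt ut (ltnW tn)) _.
by apply: p_incr; rewrite (leq_trans _ ut).
Qed.

Lemma coprime_prefix t x : 0 < t <= n.+2 -> t <= x <= n.+2 ->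
  coprime (p x) (\prod_(1 <= u < t) p u ^ alpha u).
Proof.
move=> /andP[t0 tn] /andP[tx xn]; apply: coprime_prime_powers => [|u /andP[u0 ut]].
  by apply: pp; rewrite xn (leq_trans t0).
have ux := leq_trans ut tx; split; last by rewrite ltn_eqF // p_mono.
by apply: pp; rewrite u0 (leq_trans (ltnW ux)).
Qed.

(** Multiplying by [p t ^ alpha t] multiplies the number of divisors by [alpha t + 1], the quotient
    of [p t.+1 - 1] by [p t - 1]; so the count passes from [p t - 1] to [p t.+1 - 1]. *)
Lemma tau_chain_prefix t : 0 < t <= n.+1 ->
  tau_chain 1 (prime_chain p alpha t) /\
  tau (\prod_(1 <= u < t) p u ^ alpha u) = (p t).-1.
Proof.
elim: t => // -[_ _|t IHt /andP[_ tn]].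
  by rewrite /prime_chain !big_geq // p1.
have [tc tauE] := IHt (ltnW tn).
have ppt : prime (p t.+1) by apply: pp; rewrite (leq_trans (ltnW tn)).
have E0 : 0 < \prod_(1 <= u < t.+1) p u ^ alpha u.
  rewrite big_nat_cond prodn_cond_gt0 // => u; rewrite andbT => /andP[u0 ut].
  by rewrite expn_gt0 prime_gt0 // pp // u0; lia.
have cE : coprime (p t.+1) (\prod_(1 <= u < t.+1) p u ^ alpha u).
  by apply: coprime_prefix; lia.
split; last rewrite big_nat_recr //=.
  rewrite prime_chainS // tau_chain_cat tc mul1n (big_prime_chain p alpha id) //.
  by rewrite -[X in tau_chain X]mul1n; apply: (tau_chain_nseq 0).
rewrite mulnC tau_expn_mul // tauE.
have lt := p_incr (t := t.+1); have := prime_gt1 ppt.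
have md := p_mod (t := t.+1); rewrite alphaE; last lia.
move: lt md; rewrite -!subn1; set x := p t.+1; set y := p t.+2 => lt md x1.
have {}lt : x < y by apply: lt; lia.
have {md} /eqP : y = 1 %[mod x - 1] by apply: md.
rewrite eqn_mod_dvd; last lia.
case/dvdnP=> k e; rewrite e mulnK; last lia.
(* [k] is positive because [y > 1], so the truncated [k - 1] is exact. *)
by case: k e => [|k] e; [clear -e lt x1; lia | rewrite subSS subn0].
Qed.

End CalL.

(* The hypothesis on (q - 2) (q - 3) matters only when the quotient is 1. *)
Lemma calL_slack q P : prime q -> prime P -> q < P ->
    (q - 2) * (q - 3) <= P ->
  ((P - 1) %/ (q - 1)).+2 * q.-1 < 2 * P.
Proof.
move=> pq pP qP qqP; have q1 := prime_gt1 pq; set a := _ %/ _.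
have aP : a * (q - 1) <= P - 1 by apply: leq_trunc_div.
have Pa : P - 1 < a.+1 * (q - 1) by apply: ltn_ceil; rewrite subn_gt0.
have a0 : 0 < a by rewrite divn_gt0 ?subn_gt0 // leq_sub2r // ltnW.
have P6 : P != 6 by apply: contraTneq pP => ->.
(* Only q = 5, P = 6 would violate the bound. *)
case: a a0 aP Pa => // [[|a]] _ aP Pa; last by clear -aP Pa q1 qP; nia.
(* Quotient 1 means [P <= 2 * q - 2], which is below [(q - 2) * (q - 3)] once [q >= 6]. *)
have [q6|] := leqP 6 q; first by clear -q6 qqP Pa; nia.
by clear -q1 qP P6 Pa; lia.
Qed.

Lemma count_split (T : Type) (a b : pred T) (s : seq T) :
  count a s = count (predI a b) s + count (predI a (predC b)) s.
Proof.
by elim: s => //= x s ->; case: (a x); case: (b x); rewrite /= ?addnS ?add0n.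
Qed.

(** * The formula in terms of the parts of a covering *)

(** [C_penult] corresponds to the block from [A] to [q * A], [Q_part] to the block from [A] to
    [P * A], and the rest of [C_last] to [R]. Completing the two falling factorials to factorials
    avoids division. *)
Lemma card_Gamma_calL r p alpha L (M : {fset nat}) (C : {fset nat * nat}) :
    in_calL r p alpha L -> minimal_moduli M -> lcm_of M = L -> Gamma M C ->
  let cl := #|` C_last r p C|%fset in
  let cp := #|` C_penult r p alpha C|%fset in
  let k := #|` Q_part r p alpha C|%fset in
  [/\ finite_set (Gamma M), [/\ k <= cl, cp <= p r.-1 & k <= p r]
    & #|` fset_set (Gamma M)|%fset * ((p r.-1 - cp)`! * (p r - k)`!) =
      (cl - k)`! * \prod_(1 <= i < r.+1) (p i)`! ^ alpha i].
Proof.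
move=> hL hM hlcm hC; case: hL => r1 [pp p1 p_incr] [p_mod qqP] [alphaE alpha_a alpha_P] LE.
case: r r1 pp p_incr p_mod qqP alphaE alpha_a alpha_P LE => [|[|n]] // _.
rewrite [n.+2.-1]/= subSS subSS subn0.
set q := p n.+1; set P := p n.+2 => pp p_incr p_mod qqP alphaE alpha_a alpha_P LE.
have pq : prime q by apply: pp; lia.
have pP : prime P by apply: pp; lia.
have ltqP : (q < P)%N by apply: p_incr; lia.
have [q0 P0] := (prime_gt0 pq, prime_gt0 pP).
pose E := (\prod_(1 <= u < n.+1) p u ^ alpha u)%N.
have [tcs tauE] : tau_chain 1 (prime_chain p alpha n.+1) /\ tau E = q.-1.
  by apply: (tau_chain_prefix pp p1 p_incr p_mod alphaE); rewrite /= leqnn.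
have prodE : (\prod_(x <- prime_chain p alpha n.+1) x)%N = E.
  exact: (big_prime_chain p alpha id).
have cqE : coprime q E by apply: (coprime_prefix alpha pp p_incr); lia.
have cPE : coprime P E by apply: (coprime_prefix alpha pp p_incr); lia.
have E0 : (0 < E)%N.
  rewrite /E big_nat_cond prodn_cond_gt0 // => u; rewrite andbT => /andP[u0 un].
  by rewrite expn_gt0 prime_gt0 // pp // u0; lia.
have aP : (alpha n.+1 * q.-1 < P)%N.
  rewrite alpha_a -subn1; apply: leq_ltn_trans (leq_trunc_div _ _) _.
  by rewrite subn1 ltn_predL.
have aP2 : ((alpha n.+1).+2 * q.-1 < 2 * P)%N by rewrite alpha_a calL_slack.
(* The exponent of [q] is positive as [q < P]. Its last factor is kept apart, since that block need
   not be full. *)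
have [b ab] : exists b, alpha n.+1 = b.+1.
  exists (alpha n.+1).-1; rewrite prednK // alpha_a divn_gt0 ?subn_gt0 ?prime_gt1 //.
  by rewrite leq_sub2r // ltnW.
pose A := (q ^ b * E)%N.
have qAE : (q * A = q ^ b.+1 * E)%N by rewrite mulnA -expnS.
have A0 : (0 < A)%N by rewrite muln_gt0 expn_gt0 q0.
have {}LE : L = (P * (q * A))%N.
  rewrite LE big_nat_recr //= big_nat_recr //= alpha_P ab -/q -/P -/E qAE expn1.
  by rewrite [RHS]mulnC (mulnC E).
have cPq : coprime P q by rewrite prime_coprime // dvdn_prime2 // gtn_eqF.
have cPA : coprime P (q * A) by rewrite qAE coprimeMr coprimeXr.
have [cov modC] := hC; have [C2 injC _] := cov.
have ML m : m \in M -> (1 < m)%N /\ m %| (P * (q * A))%N.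
  move=> mM; rewrite -LE -hlcm dvdn_lcm_of //; split=> //.
  by move: mM; rewrite -modC => /imfsetP[c /= /C2[]] + _ ->.
have [res resE] := covering_residues cov modC.
have covM z : exists2 m, m \in M & (z = res m %[mod m])%N.
  have [_ _ /(_ (Posz z))[c]] := cov; rewrite resE => /andP[cM /eqP ->].
  by rewrite !modz_nat => -[zc]; exists c.2.
have prod_ds : (\prod_(x <- prime_chain p alpha n.+1 ++ nseq b q) x)%N = A.
  by rewrite big_cat prodE /= prod_nseq mulnC.
have full : chain_full M 1 (prime_chain p alpha n.+1 ++ nseq b q).
  have := @covering_chain_full M res (fset_uniq M)
    (prime_chain p alpha n.+1) q (alpha n.+1) P.
  rewrite prodE ab /= -qAE; apply=> //; rewrite -?ab //.
have tauA : tau (q * A) = (tau A + q.-1)%N by rewrite qAE tau_prime_mul // tauE.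
have cpq : (size (block M A (q * A)) < q)%N.
  have := size_block (fset_uniq M) q0 A0 tauA; rewrite -ltnS prednK //.
have ds_prime : all prime (prime_chain p alpha n.+1 ++ nseq b q).
  by rewrite all_cat (tau_chain_prime tcs) all_nseq pq orbT.
have qP : q != P by rewrite ltn_eqF.
have := @Gamma_factorization M (prime_chain p alpha n.+1 ++ nseq b q) q P hM
  ds_prime pq pP qP.
rewrite prod_ds => /(_ ML full cpq)[fin kP cardE].
have PE m : m \in M -> (P %| m) = ~~ (m %| q * A)%N.
  move=> /ML[_ mL]; have := @dvdn_prime_power_top P 0 (q * A) m pP cPA.
  by rewrite expn1 mul1n; apply.
have exP m : m \in M -> exact_dvd P 1 m = ~~ (m %| q * A)%N.
  move=> mM; rewrite /exact_dvd expn1 PE // (@not_dvdn_prime_power P 1 (q * A)) ?andbT //.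
    by rewrite muln_gt0 q0.
  by rewrite expn1; case: (ML m mM).
have penE : #|` C_penult n.+2 p alpha C|%fset = size (block M A (q * A)).
  rewrite (card_filter_moduli (fun m => exact_dvd q (alpha n.+1) m && ~~ (P %| m))
    cov modC) size_filter.
  apply: eq_in_count => m mM /=; rewrite PE // negbK andbC.
  have [mqA|//] := boolP (m %| q * A)%N; rewrite /= /exact_dvd ab.
  rewrite qAE in mqA.
  by rewrite (dvdn_prime_power_top pq cqE mqA) (not_dvdn_prime_power pq E0 cqE mqA) andbT.
have lastE : #|` C_last n.+2 p C|%fset = count (fun m => ~~ (m %| q * A)%N) M.
  rewrite (card_filter_moduli (exact_dvd P 1) cov modC).
  by apply: eq_in_count => m mM; rewrite exP.
have blockP : size (block M A (P * A)) =
    count (fun m => ~~ (m %| q * A)%N && (m %| P * A)%N) M.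
  rewrite size_filter; apply: eq_in_count => m mM /=; rewrite andbC.
  have [mPA|] := boolP (m %| P * A)%N; rewrite ?andbT ?andbF //.
  congr negb; apply/idP/idP => [/(dvdn_mull q)//|mqA].
  by apply: (dvdn_cancel_prime pq mqA mPA); rewrite dvdn_prime2.
have QE : #|` Q_part n.+2 p alpha C|%fset = size (block M A (P * A)).
  have -> : Q_part n.+2 p alpha C = [fset c in C | exact_dvd P 1 c.2 &&
      ~~ (q ^ alpha n.+1 %| c.2)%N]%fset.
    by apply/fsetP=> c; rewrite !inE /= andbA.
  rewrite (card_filter_moduli (fun m => exact_dvd P 1 m && ~~ (q ^ alpha n.+1 %| m)%N)
    cov modC) blockP.
  apply: eq_in_count => m mM /=; rewrite exP // ab; congr andb.
  have [_ mL] := ML m mM.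
  (* With [P * E] as cofactor, a modulus lacking the full power of [q] divides
     [q ^ b * (P * E) = P * A]. *)
  rewrite (@dvdn_prime_power_top q b (P * E)) ?negbK //.
  - by rewrite mulnCA.
  - by rewrite coprimeMr cqE coprime_sym cPq.
  - by rewrite mulnCA -qAE.
have RE : size [seq m <- M | ~~ (m %| q * A)%N && ~~ (m %| P * A)%N] =
    (#|` C_last n.+2 p C|%fset - size (block M A (P * A)))%N.
  rewrite lastE blockP (count_split _ (fun m => m %| P * A)%N) size_filter.
  by rewrite addKn.
move=> cl cp k; rewrite /cl /cp /k penE QE.
split=> //.
  split=> //; last exact: ltnW.
  by rewrite lastE blockP; apply: sub_count => m /andP[].
rewrite -RE cardE; set R := size (seq.filter _ _).
set cp' := size _ in cpq *; set k' := size _ in kP *.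
have -> : \prod_(1 <= i < n.+3) (p i)`! ^ alpha i =
    \prod_(x <- prime_chain p alpha n.+1 ++ nseq b q) x`! * q`! * P`!.
  rewrite big_cat big_nat_recr //= big_nat_recr //= alpha_P ab -/q -/P expn1.
  rewrite (big_prime_chain p alpha (fun x => x`!)) // expnSr !mulnA; congr (_ * _ * _ * _).
  by elim: (b) => [|c IHc]; rewrite ?big_nil // big_cons -IHc expnS.
rewrite -(ffact_fact (ltnW cpq)) -(ffact_fact kP).
ring.
Qed.

(** * Passage to the rational formula *)

Local Open Scope ring_scope.

Theorem theorem3 (r : nat) (p alpha : nat -> nat) (L : nat)
    (hL : in_calL r p alpha L)
    (M : {fset nat}) (hM : minimal_moduli M) (hlcm : lcm_of M = L)
    (C : {fset nat * nat}) (hC : Gamma M C) :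
  let cl := #|` C_last r p C|%fset in
  let cp := #|` C_penult r p alpha C|%fset in
  let q := #|` Q_part r p alpha C|%fset in
  [/\ finite_set (Gamma M),
      [/\ (q <= cl)%N, (cp <= p r.-1)%N & (q <= p r)%N]
    & (#|` fset_set (Gamma M)|%fset)%:R =
        ((cl - q)`!)%:R / (((p r.-1 - cp)`!)%:R * ((p r - q)`!)%:R)
        * (\prod_(1 <= i < r.+1) ((p i)`! ^ alpha i)%N)%:R :> rat].
Proof.
move=> cl cp q; have [fin [qcl cpp qp] card] := card_Gamma_calL hL hM hlcm hC.
split=> //; move/(congr1 (fun n => n%:R : rat)): card.
rewrite !natrM -/cl -/cp -/q mulrAC => <-.
have f0 x : (x`!)%:R != 0 :> rat by rewrite pnatr_eq0 -lt0n fact_gt0.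
by rewrite mulfK // mulf_neq0.
Qed.
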